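(* Let $k\ge d\ge 3$ be fixed. Suppose that $\mathcal{F}\subset\binom{[n]}{k}$ is a $(d,2k+d-3)$-conditionally intersecting family. Then $\mathcal{F}$ can be partitioned into three families $\mathcal{H}$, $\mathcal{B}$ and $\mathcal{S}$, and the ground set $[n]$ can be partitioned into two subsets $Y$ and $Z$, such that the following statements hold. (a) $\mathcal{H}\subset\binom{Y}{k}$ and every set $H\in\mathcal{H}$ contains a unique $(k-1)$-subset. (b) $Z$ has a partition $Z=V_1\cup\cdots\cup V_t$ with each $V_i$ of size at most $2k$ such that $\mathcal{B}\subset\bigcup_{i=1}^{t}\binom{V_i}{k}$ (that is, $\mathcal{B}$ is a vertex-disjoint union of $k$-graphs each on at most $2k$ vertices). (c) $\mathcal{S}\subset\binom{[n]}{k}\setminus\binom{Y}{k}$, and for every set $S\in\mathcal{S}$ and every $i\in\{1,\ldots,t\}$ (with $V_1,\dots,V_t$ the parts from (b)), the size of $S\cap V_i$ is either $0$ or at least $d$.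
   Context: $[n]=\{1,\ldots,n\}$, and $\binom{V}{k}$ denotes the collection of all $k$-element subsets of $V$. A family $\mathcal{F}\subset\binom{[n]}{k}$ is called $(d,s)$-conditionally intersecting if there do not exist $d$ distinct sets $A_1,\ldots,A_d\in\mathcal{F}$ with $|A_1\cup\cdots\cup A_d|\le s$ and $A_1\cap\cdots\cap A_d=\emptyset$. For a family $\mathcal{H}\subset 2^{[n]}$ and $H\in\mathcal{H}$, a subset $G\subset H$ is called unique if no set of $\mathcal{H}$ other than $H$ contains $G$. The families and vertex sets in the partitions ($\mathcal{H},\mathcal{B},\mathcal{S}$, and $Y,Z$) are allowed to be empty, and $t=0$ is allowed. *)

(* Defs.v *)
From mathcomp Require Import all_boot.

Set Implicit Arguments.
Unset Strict Implicit.
Unset Printing Implicit Defensive.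

Section Families.

Variable T : finType.
Implicit Types (F H D : {set {set T}}) (V A G : {set T}).

Definition ksubsets V (k : nat) : {set {set T}} :=
  [set A : {set T} | A \subset V & #|A| == k].

Definition conditionally_intersecting (d s : nat) F : Prop :=
  ~ exists D, [/\ D \subset F, #|D| = d,
                  #|cover D| <= s & \bigcap_(A in D) A = set0].

Definition unique_subset H A G : Prop :=
  G \subset A /\ forall A', A' \in H -> G \subset A' -> A' = A.

(* Unlike [partition], the two definitions below allow empty parts. *)
Definition partition_into2 (U : finType) (X A B : {set U}) : Prop :=
  A :|: B = X /\ [disjoint A & B].

Definition partition_into3 (U : finType) (X A B C : {set U}) : Prop :=
  [/\ A :|: B :|: C = X, [disjoint A & B],
      [disjoint A & C] & [disjoint B & C]].

End Families.

(* Main.v *)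
(** Call a member [A] of the family bad if every [A :\ x], [x \in A], lies in
another member [f x |: A :\ x].  Put [V := A :|: f @: A], so [#|V| <= 2k].
Every member [E] meeting [V] meets it in at least [d] points, since otherwise
some of the sets [E], [A], [f x |: A :\ x] form a forbidden configuration.
Deleting such sets [V] from the ground set, badness being judged among the
members that lie in what is left, yields the parts; in the end every member
inside the remainder [Y] has a unique (k-1)-subset.  All members not inside [Y]
can go to [S], so that [B] is empty. *)
Require Import Defs.
From mathcomp Require Import all_boot.
From mathcomp Require Import zify.

(** * One-point exchanges of a set, and sets of intermediate size *)

Section Exchange.

Variables (T : finType) (A : {set T}) (f : T -> T).
Hypothesis fNA : forall x, x \in A -> f x \notin A.

Let exch x := f x |: A :\ x.

Lemma exchange_notin x : x \in A -> x \notin exch x.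
Proof.
move=> Ax; rewrite !inE eqxx /= orbF.
by apply: contra (fNA x Ax) => /eqP <-.
Qed.

Lemma exchange_inj : {in A &, injective exch}.
Proof.
move=> x y Ax Ay exy; apply/eqP; apply: contraNT (exchange_notin y Ay) => nxy.
by rewrite -exy !inE [y == x]eq_sym nxy Ay orbT.
Qed.

Lemma card_exchangeI x : x \in A -> #|exch x :&: A| = #|A|.-1.
Proof.
move=> Ax; rewrite (cardsD1 x A) Ax /=; congr #|pred_of_set _|.
apply/setP=> z; rewrite !inE; case: eqP => [->|_] /=.
  by rewrite (negPf (fNA x Ax)) andbF.
by rewrite -andbA andbb.
Qed.

Lemma exchange_sub (X : {set T}) x : x \in X -> exch x \subset A :|: f @: X.
Proof.
move=> Xx; rewrite subUset sub1set in_setU imset_f // orbT /=.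
exact: subset_trans (subD1set _ _) (subsetUl _ _).
Qed.

End Exchange.

Lemma subset_extend (T : finType) (A B : {set T}) m :
  B \subset A -> #|B| <= m <= #|A| ->
  exists X : {set T}, [/\ B \subset X, X \subset A & #|X| = m].
Proof.
elim: m => [|m IH] sBA /andP[leBm lemA].
  by exists B; split=> //; apply/eqP; rewrite -leqn0.
have [eqBm|neBm] := eqVneq #|B| m.+1; first by exists B.
have [|X [sBX sXA cX]] := IH sBA; first by lia.
have /properP[_ [x Ax nXx]] : X \proper A by rewrite properEcard sXA cX.
exists (x |: X); split; last by rewrite cardsU1 nXx cX.
  exact: subset_trans sBX (subsetUr _ _).
by rewrite subUset sub1set Ax.
Qed.

(** * How members of the family meet the part built from a bad set *)

Section BadSet.

Variables (T : finType) (k d : nat) (F : {set {set T}}).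
Hypotheses (d_ge3 : 3 <= d) (d_le_k : d <= k).
Hypothesis F_uniform : forall A, A \in F -> #|A| = k.
Hypothesis F_ci : conditionally_intersecting d (2 * k + d - 3) F.

Variables (A : {set T}) (f : T -> T).
Hypotheses (FA : A \in F) (fNA : forall x, x \in A -> f x \notin A).
Hypothesis Fexch : forall x, x \in A -> f x |: A :\ x \in F.

Let exch x := f x |: A :\ x.

(** The [d] distinct members [E], [A] and [exch x], for [x] in [X], have no common point: such a
    point [z] would lie in [E :&: A], hence in [X], but [exch z] misses [z]. So their union must be
    large. *)
Lemma bad_set_no_cover (E X : {set T}) :
  E \in F -> X \subset A -> E :&: A \subset X -> #|X| = d - 2 ->
  2 * k + d - 3 < #|E :|: A :|: f @: X|.
Proof.
move=> FE sXA sEAX cX; rewrite ltnNge; apply/negP=> leU; apply: F_ci.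
have cA := F_uniform _ FA; have := subset_leq_card sEAX; rewrite cX => leEA.
exists (E |: (A |: exch @: X)); split.
- rewrite !subUset !sub1set FE FA /=.
  by apply/subsetP=> _ /imsetP[x Xx ->]; apply/Fexch/(subsetP sXA).
- have AN : A \notin exch @: X.
    apply/imsetP=> -[x Xx eA]; have Ax := subsetP sXA x Xx.
    by have := exchange_notin _ _ _ fNA _ Ax; rewrite -/(exch x) -eA Ax.
  (* [E] shares at most [d - 2] points with [A]; the other sets share at least [k - 1]. *)
  have EN : E \notin A |: exch @: X.
    apply/negP=> /setU1P[eE|/imsetP[x Xx eE]].
      by move: leEA; rewrite eE setIid; lia.
    have := card_exchangeI _ _ _ fNA _ (subsetP sXA x Xx).
    by move: leEA; rewrite eE /exch; lia.
  rewrite !cardsU1 EN AN card_in_imset ?cX; first by lia.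
  by move=> x y /(subsetP sXA) + /(subsetP sXA); apply: exchange_inj.
- apply: leq_trans leU; apply/subset_leq_card/bigcupsP=> C.
  case/setU1P=> [->|/setU1P[->|/imsetP[x Xx ->]]].
  + by rewrite -setUA subsetUl.
  + by rewrite setUAC subsetUr.
  + by rewrite -setUA subsetU // exchange_sub ?orbT.
- apply/eqP; rewrite -subset0; apply/subsetP=> z /bigcapP zD.
  have Ez : z \in E by apply: zD; rewrite setU11.
  have Az : z \in A by apply: zD; rewrite setU1r ?setU11.
  have Xz : z \in X by rewrite (subsetP sEAX) // inE Ez.
  have: z \in exch z by apply: zD; rewrite !setU1r ?imset_f.
  by rewrite (negPf (exchange_notin _ _ _ fNA _ Az)).
Qed.

(** Here the forbidden configuration is [E] with the [d - 1] sets [exch x], for [x] in [E :&: A],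
    without [A] itself. If [E] avoided every [f x], a common point would lie in [E :&: A] and be
    missed by its own exchange. *)
Lemma bad_set_pred_d (E : {set T}) :
  E \in F -> #|E :&: A| = d.-1 -> exists2 x, x \in A & f x \in E.
Proof.
move=> FE cEA; apply/exists_inP; apply: contraT => /exists_inPn fNE.
have sXA : E :&: A \subset A by apply: subsetIr.
case: F_ci; exists (E |: exch @: (E :&: A)); split.
- rewrite subUset sub1set FE /=.
  by apply/subsetP=> _ /imsetP[x Xx ->]; apply/Fexch/(subsetP sXA).
- have EN : E \notin exch @: (E :&: A).
    apply/imsetP=> -[x /(subsetP sXA) Ax eE].
    by have := fNE x Ax; rewrite eE setU11.
  rewrite cardsU1 EN card_in_imset ?cEA; first by lia.
  by move=> x y /(subsetP sXA) + /(subsetP sXA); apply: exchange_inj.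
- have: #|E :|: A :|: f @: (E :&: A)| <= 2 * k + d - 3.
    apply: leq_trans (leq_card_setU _ _) _.
    have := leq_imset_card f (E :&: A); have := cardsUI E A.
    by rewrite (F_uniform _ FE) (F_uniform _ FA) cEA; lia.
  apply: leq_trans; apply/subset_leq_card/bigcupsP=> C.
  case/setU1P=> [->|/imsetP[x Xx ->]]; rewrite -setUA ?subsetUl //.
  by rewrite subsetU // exchange_sub ?orbT.
- apply/eqP; rewrite -subset0; apply/subsetP=> z /bigcapP zD.
  have Ez : z \in E by apply: zD; rewrite setU11.
  have zX x : x \in E :&: A -> z \in exch x.
    by move=> Xx; apply: zD; rewrite setU1r ?imset_f.
  have /set0Pn[x Xx] : E :&: A != set0 by rewrite -card_gt0; lia.
  have Az : z \in A.
    case/setU1P: (zX x Xx) => [ez|/setD1P[] //].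
    by have := fNE x (subsetP sXA x Xx); rewrite -ez Ez.
  have := zX z; rewrite inE Ez Az => /(_ isT).
  by rewrite (negPf (exchange_notin _ _ _ fNA _ Az)).
Qed.

(** By the size of [E :&: A]: [d] points suffice; with [d - 1], some [f x] in [E] supplies one more;
    with none, [E] cannot meet [f @: A] either; sizes from 1 to [d - 2] are impossible. *)
Lemma bad_set_meets (E : {set T}) :
  E \in F -> #|E :&: (A :|: f @: A)| = 0 \/ d <= #|E :&: (A :|: f @: A)|.
Proof.
move=> FE; set V := A :|: _.
have [cE cA] := (F_uniform _ FE, F_uniform _ FA).
have sEA : E :&: A \subset A by apply: subsetIr.
have sEV : E :&: A \subset E :&: V by rewrite setIS ?subsetUl.
have cUI := cardsUI E A; rewrite cE cA in cUI.
have [ge_d|lt_d] := leqP d #|E :&: A|.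
  by right; apply: leq_trans ge_d (subset_leq_card sEV).
have [eq_d|ne_d] := eqVneq #|E :&: A| d.-1.
  have [x Ax Efx] := bad_set_pred_d _ FE eq_d; right.
  have : E :&: A \proper E :&: V.
    apply/properP; split=> //; exists (f x).
      by rewrite !inE Efx imset_f ?orbT.
    by rewrite inE (negPf (fNA x Ax)) andbF.
  by move/proper_card; lia.
have [eq0|ne0] := eqVneq #|E :&: A| 0.
  left; apply/eqP; rewrite cards_eq0; apply: contraT => /set0Pn[y].
  have /eqP EA0 : E :&: A == set0 by rewrite -cards_eq0 eq0.
  case/setIP=> Ey /setUP[Ay|/imsetP[x Ax ey]].
    by have := in_set0 y; rewrite -EA0 inE Ey Ay.
  have [||X [sxX sXA cX]] := @subset_extend _ A [set x] (d - 2).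
  - by rewrite sub1set.
  - by rewrite cards1 cA; lia.
  have := bad_set_no_cover _ _ FE sXA; rewrite EA0 sub0set => /(_ isT cX).
  have Xx : x \in X by rewrite -sub1set.
  (* As [f x] is the point [y] of [E], at most [d - 3] points are added to the at most [2k] points
     of [E :|: A]. *)
  have -> : E :|: A :|: f @: X = E :|: A :|: f @: (X :\ x).
    rewrite -{1}(setD1K Xx) imsetU1 -ey setUA; congr (_ :|: _).
    by apply/setUidPl; rewrite sub1set inE Ey.
  have := leq_of_leqif (leq_card_setU (E :|: A) (f @: (X :\ x))).
  have := leq_imset_card f (X :\ x).
  by have := cardsD1 x X; rewrite Xx cX; lia.
(* A shared point leaves at most [2k - 1] points in [E :|: A], and [f @: X] adds at most [d - 2]. *)
have [|X [sEX sXA cX]] := @subset_extend _ A (E :&: A) (d - 2) sEA.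
  by rewrite cA; lia.
have := bad_set_no_cover _ _ FE sXA sEX cX.
have := leq_of_leqif (leq_card_setU (E :|: A) (f @: X)).
by have := leq_imset_card f X; rewrite cX; lia.
Qed.

End BadSet.

(** * Deleting parts until no bad member remains *)

Lemma exchange_of_superset {T : finType} (A C : {set T}) x :
  #|C| = #|A| -> x \in A -> A :\ x \subset C -> C != A ->
  exists2 y, y \notin A & C = y |: A :\ x.
Proof.
move=> cC Ax sAC nCA; have cAx := cardsD1 x A; rewrite Ax in cAx.
have /properP[_ [y Cy nAy]] : A :\ x \proper C by rewrite properEcard sAC; lia.
have eC : y |: A :\ x = C.
  by apply/eqP; rewrite eqEcard subUset sub1set Cy sAC cardsU1 nAy; lia.
exists y => //; apply: contra nCA => Ay.
move: nAy; rewrite !inE Ay andbT negbK => /eqP ey.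
by rewrite -eC ey setD1K.
Qed.

Section Decomposition.

Variables (T : finType) (k d : nat) (F : {set {set T}}).
Hypotheses (d_ge3 : 3 <= d) (d_le_k : d <= k).
Hypothesis F_uniform : forall A, A \in F -> #|A| = k.
Hypothesis F_ci : conditionally_intersecting d (2 * k + d - 3) F.

Definition has_unique_point (Y A : {set T}) :=
  [exists x in A, [forall C in F,
     (C \subset Y) ==> (A :\ x \subset C) ==> (C == A)]].

(** Having the same size as [A], another member containing [A :\ x] is a one-point exchange of [A];
    finite choice collects the new points into [f]. *)
Lemma bad_set_exchange (Y A : {set T}) :
  A \in F -> ~~ has_unique_point Y A ->
  exists f : T -> T, forall x, x \in A ->
    [/\ f x \notin A, f x |: A :\ x \in F & f x |: A :\ x \subset Y].
Proof.
move=> FA /exists_inPn badA.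
have choose x : exists y, x \in A ->
    [/\ y \notin A, y |: A :\ x \in F & y |: A :\ x \subset Y].
  (* Outside [A] the value of [f] is arbitrary. *)
  have [Ax|] := boolP (x \in A); last by exists x.
  have /forall_inPn[C FC] := badA x Ax.
  rewrite !negb_imply => /and3P[sCY sAC nCA].
  have [|y nAy eC] := exchange_of_superset _ _ _ _ Ax sAC nCA.
    by rewrite !F_uniform.
  by exists y => _; rewrite -eC.
by have [f fP] := fin_all_exists choose; exists f.
Qed.

(** All of [F] is tested, not only the members inside the remainder, so the property survives later
    deletions and covers the members sent to [S]. *)
Definition good_part (V : {set T}) : Prop :=
  #|V| <= 2 * k /\
  forall E, E \in F -> #|E :&: V| = 0 \/ d <= #|E :&: V|.

(** Induction on [#|Y|]: a bad member yields a part [V] that is moved from [Y] into the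
    partition. *)
Lemma exists_good_parts (Y : {set T}) (P : {set {set T}}) :
  partition P (~: Y) -> (forall V, V \in P -> good_part V) ->
  exists Y' P', [/\ partition P' (~: Y'), forall V, V \in P' -> good_part V &
    forall A, A \in F -> A \subset Y' -> has_unique_point Y' A].
Proof.
have [m] := ubnP #|Y|; elim: m => // m IH in Y P * => ltYm partP goodP.
have [/forall_inP allY|] := boolP [forall A in F,
    (A \subset Y) ==> has_unique_point Y A].
  by exists Y, P; split=> // A FA; apply/implyP/allY.
case/forall_inPn=> A FA; rewrite negb_imply => /andP[sAY badA].
have [f fP] := bad_set_exchange _ _ FA badA.
pose V := A :|: f @: A; have cA := F_uniform _ FA.
have sVY : V \subset Y.
  rewrite subUset sAY; apply/subsetP=> _ /imsetP[x Ax ->].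
  by have [_ _ /subsetP sY] := fP x Ax; rewrite sY ?setU11.
(* Needed twice: [Y] must shrink, and a [partition] has no empty block. *)
have V0 : V != set0.
  have := subset_leq_card (subsetUl A (f @: A)).
  by rewrite -card_gt0 cA /V; lia.
have goodV : good_part V.
  split.
    apply: leq_trans (leq_card_setU _ _) _.
    by have := leq_imset_card f A; rewrite cA; lia.
  move=> E FE.
  by apply: (bad_set_meets _ _ _ _ d_ge3 d_le_k F_uniform F_ci) => // x /fP[].
apply: (IH (Y :\: V) (V |: P)).
- have := cardsID V Y; rewrite (setIidPr sVY).
  by move: V0; rewrite -card_gt0; lia.
- have -> : ~: (Y :\: V) = V :|: ~: Y by rewrite setDE setCI setCK setUC.
  apply: partitionU1 => //.
  by rewrite disjoint_sym disjoints_subset setCS.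
- by move=> W /setU1P[->|/goodP].
Qed.

End Decomposition.

Theorem theorem1p6 (n k d : nat) (F : {set {set 'I_n}})
  (d_ge3 : 3 <= d) (d_le_k : d <= k)
  (F_uniform : F \subset ksubsets [set: 'I_n] k)
  (F_ci : conditionally_intersecting d (2 * k + d - 3) F) :
  exists (H B S : {set {set 'I_n}}) (Y Z : {set 'I_n}) (P : {set {set 'I_n}}),
    [/\ partition_into3 F H B S,
        partition_into2 [set: 'I_n] Y Z,
        (* (a) *)
        H \subset ksubsets Y k /\
        (forall A : {set 'I_n}, A \in H ->
           exists G : {set 'I_n}, #|G| = k - 1 /\ unique_subset H A G),
        (* (b) *)
        [/\ partition P Z,
            forall V : {set 'I_n}, V \in P -> #|V| <= 2 * k &
            B \subset \bigcup_(V in P) ksubsets V k] &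
        (* (c) *)
        S \subset ksubsets [set: 'I_n] k :\: ksubsets Y k /\
        (forall A V : {set 'I_n}, A \in S -> V \in P ->
           #|A :&: V| = 0 \/ d <= #|A :&: V|)].
Proof.
have cF A : A \in F -> #|A| = k.
  by move/(subsetP F_uniform); rewrite inE => /andP[_ /eqP].
have [||Y [P [partP goodP uniqY]]] :=
  exists_good_parts _ k d F d_ge3 d_le_k cF F_ci setT set0.
- by rewrite setCT /partition /trivIset /cover !big_set0 cards0 inE !eqxx.
- by move=> V; rewrite inE.
exists (F :&: ksubsets Y k), set0, (F :\: ksubsets Y k), Y, (~: Y), P; split.
- split; rewrite ?setU0 ?setID //.
  + by rewrite disjoints_subset setC0 subsetT.
  + by rewrite -setI_eq0 setDE setIACA setICr setI0.
  + by rewrite disjoints_subset sub0set.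
- by split; rewrite ?setUCr // disjoints_subset setCK.
- split; first exact: subsetIr.
  move=> A /setIP[FA]; rewrite inE => /andP[sAY /eqP cA].
  (* Removing this point [x] from [A] gives the unique subset. *)
  have /exists_inP[x Ax /forall_inP uniqA] := uniqY A FA sAY.
  exists (A :\ x); split; first by have := cardsD1 x A; rewrite Ax; lia.
  split=> [|C /setIP[FC]]; first exact: subD1set.
  rewrite inE => /andP[sCY _] sAC; apply/eqP.
  by have := uniqA C FC; rewrite sCY sAC.
- by split=> // [V /goodP[]|]; rewrite ?sub0set.
- split; first exact: setSD.
  by move=> A V /setDP[FA _] /goodP[_ /(_ A FA)].
Qed.
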